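(* For each $n\ge 3$ let $r_n=\sup_P \dfrac{2\,\mathrm{FWP}(P)}{\mathrm{MTSP}(P)}$, the supremum taken over all (multi)sets $P$ of $n$ points in $\mathbb{R}^2$ with $\mathrm{MTSP}(P)>0$. Then $r_n\to 2/\sqrt{3}$ as $n\to\infty$.
   Context: For a finite (multi)set $P\subset\mathbb{R}^2$, $\mathrm{FWP}(P)=\min_{c\in\mathbb{R}^2}\sum_{p\in P} d(c,p)$ with $d$ the Euclidean distance (the Fermat–Weber value of $P$), and $\mathrm{MTSP}(P)$ is the maximum total Euclidean length of a Hamiltonian cycle (tour) through all points of $P$ (the Maximum Traveling Salesman Problem). *)

(* Defs.v *)
From HB Require Import structures.
From mathcomp Require Import all_boot all_order all_algebra all_fingroup.
From mathcomp Require Import all_classical all_reals all_analysis.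
Set Implicit Arguments. Unset Strict Implicit. Unset Printing Implicit Defensive.
Import Order.TTheory GRing.Theory Num.Theory.
Import numFieldNormedType.Exports.
Local Open Scope classical_set_scope.
Local Open Scope ring_scope.

Section Defs.
Variable R : realType.

Definition edist (p q : R * R) : R :=
  Num.sqrt ((p.1 - q.1) ^+ 2 + (p.2 - q.2) ^+ 2).

(* Fermat-Weber value of the multiset P = (P 0, ..., P (n-1)) *)
Definition FWP (n : nat) (P : 'I_n -> R * R) : R :=
  inf [set \sum_(i < n) edist c (P i) | c in [set: R * R]].

Definition tour_length (n : nat) (P : 'I_n -> R * R) (s : {perm 'I_n}) : R :=
  \sum_(i < n) edist (P (s i)) (P (s (ordS i))).

Definition MTSP (n : nat) (P : 'I_n -> R * R) : R :=
  \big[Num.max/0]_(s : {perm 'I_n}) tour_length P s.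

Definition r_n (n : nat) : R :=
  sup [set x | exists P : 'I_n -> R * R, 0 < MTSP P /\ x = 2 * FWP P / MTSP P].

End Defs.

(* Main.v *)
Require Import Defs.
From HB Require Import structures.
From mathcomp Require Import all_boot all_order all_algebra all_fingroup.
From mathcomp Require Import all_classical all_reals all_analysis.
From mathcomp Require Import ring lra.
Set Implicit Arguments. Unset Strict Implicit. Unset Printing Implicit Defensive.
Import Order.TTheory GRing.Theory Num.Theory.
Import numFieldNormedType.Exports.
Local Open Scope classical_set_scope.
Local Open Scope ring_scope.

(** The bound from above compares a tour with an assignment [s] maximising
    [cost s], the sum of the distances from [P i] to [P (s i)] over all
    permutations.

    Linear programming duality for assignments, symmetrised, gives radii [r i]
    with [dist (P i) (P j) <= r i + r j] and [2 * \sum_i r i = cost s].  In the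
    plane, pairwise intersecting disks acquire a common point after scaling by
    [2 / sqrt 3]; the sum of distances to that point shows that the
    Fermat-Weber value is at most [cost s / sqrt 3].

    Conversely the cycles of [s] can be merged into a single tour at the expense
    of [o(1) * cost s]: exchanging the successors of [a] and [b] loses at most
    [|x| + |y| - |x + y|], where [x] and [y] are the displacements at [a] and
    [b].  As long as there are more than about [8 k] cycles, two of them have
    displacements with almost equal directions and the loss is at most
    [cost s / k ^ 2]; afterwards one merges at a shortest edge, which loses at
    most [2 * cost s / n].  The total is small if [k] is a small multiple of
    [n].

    The bound from below comes from points spread evenly over the vertices of
    an equilateral triangle. *)

(* Qualified because MathComp-Analysis has another [edist]. *)
Local Notation dist := Defs.edist.

(** * The Euclidean norm of the plane *)

Section Plane.
Variable R : realType.
Implicit Types a b c d e : R.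

Definition hyp a b : R := Num.sqrt (a ^+ 2 + b ^+ 2).

Lemma hyp_ge0 a b : 0 <= hyp a b.
Proof. exact: sqrtr_ge0. Qed.

Lemma sqr_hyp a b : hyp a b ^+ 2 = a ^+ 2 + b ^+ 2.
Proof. by rewrite sqr_sqrtr // addr_ge0 // sqr_ge0. Qed.

Lemma hypN a b : hyp (- a) (- b) = hyp a b.
Proof. by rewrite /hyp !sqrrN. Qed.

Lemma hypC a b : hyp a b = hyp b a.
Proof. by rewrite /hyp addrC. Qed.

Lemma dot_le_hyp a b c d : a * c + b * d <= hyp a b * hyp c d.
Proof.
have [lt0|ge0] := ltP (a * c + b * d) 0.
  by rewrite (le_trans (ltW lt0)) // mulr_ge0 ?hyp_ge0.
rewrite -(@ler_pXn2r _ 2) ?nnegrE ?mulr_ge0 ?hyp_ge0 // exprMn !sqr_hyp.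
have := sqr_ge0 (a * d - b * c); lra.
Qed.

Lemma hypD a b c d : hyp (a + c) (b + d) <= hyp a b + hyp c d.
Proof.
rewrite -(@ler_pXn2r _ 2) ?nnegrE ?addr_ge0 ?hyp_ge0 // sqr_hyp.
have := dot_le_hyp a b c d; have := sqr_hyp a b; have := sqr_hyp c d; nra.
Qed.

Lemma le_hyp_l a b : `|a| <= hyp a b.
Proof. by rewrite -sqrtr_sqr ler_wsqrtr // lerDl sqr_ge0. Qed.

(** With [X], [Y], [Z] the three norms, [(X + Y)^2 - Z^2] is twice the gap between [X Y] and the dot
    product. By Lagrange's identity the gap is at most the squared cross product over [X Y], and the
    cross product is, up to sign, [a c] times the difference of slopes. *)
Lemma hypD_cone a b c d e : 0 < a -> `|b| <= a -> 0 < c -> `|d| <= c ->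
    `|b / a - d / c| <= e ->
  hyp a b + hyp c d <= hyp (a + c) (b + d) + e ^+ 2 * (hyp a b + hyp c d).
Proof.
move=> a0 ba c0 dc se.
have aX : a <= hyp a b by apply: le_trans (le_hyp_l a b); rewrite ler_norm.
have cY : c <= hyp c d by apply: le_trans (le_hyp_l c d); rewrite ler_norm.
have e0 : 0 <= e by apply: le_trans se.
have X2 := sqr_hyp a b; have Y2 := sqr_hyp c d.
have Z2 := sqr_hyp (a + c) (b + d); have Z0 := hyp_ge0 (a + c) (b + d).
set X := hyp a b in aX X2 *; set Y := hyp c d in cY Y2 *.
set Z := hyp (a + c) _ in Z2 Z0 *.
have XY0 : 0 < X * Y by rewrite mulr_gt0 ?(lt_le_trans _ aX) ?(lt_le_trans _ cY).
have D0 : 0 <= a * c + b * d.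
  have : `|b * d| <= a * c by rewrite normrM ler_pM.
  by rewrite ler_norml; lra.
have acXY : a * c <= X * Y by rewrite ler_pM // ltW.
have ac0 : 0 < a * c by rewrite mulr_gt0.
have cr : (a * d - b * c) ^+ 2 <= e ^+ 2 * (a * c) ^+ 2.
  have -> : a * d - b * c = - ((b / a - d / c) * (a * c)) by field; rewrite !gt_eqF.
  rewrite sqrrN exprMn ler_wpM2r ?sqr_ge0 // -[leLHS]real_normK ?num_real //.
  by rewrite ler_pXn2r ?nnegrE.
have prodE : (X * Y - (a * c + b * d)) * (X * Y + (a * c + b * d)) =
    (a * d - b * c) ^+ 2.
  by rewrite -subr_sqr exprMn X2 Y2; ring.
have dXY : a * c + b * d <= X * Y by exact: dot_le_hyp.
have gap : X * Y - (a * c + b * d) <= e ^+ 2 * (X * Y).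
  rewrite -(ler_pM2r XY0).
  apply: (@le_trans _ _ ((a * d - b * c) ^+ 2)).
    rewrite -prodE ler_wpM2l ?subr_ge0 //; lra.
  apply: (le_trans cr); rewrite -(mulrA (e ^+ 2)) ler_wpM2l ?sqr_ge0 //.
  by rewrite -expr2 ler_pXn2r ?nnegrE ?(ltW ac0) ?(ltW XY0).
have S0 : 0 < X + Y by apply: lt_le_trans (lerD aX cY); rewrite addr_gt0.
have ZS : Z <= X + Y by exact: hypD.
rewrite -lerBlDl -(ler_pM2r S0).
apply: (@le_trans _ _ ((X + Y - Z) * (X + Y + Z))).
  by rewrite ler_wpM2l ?subr_ge0 // lerDl.
have -> : (X + Y - Z) * (X + Y + Z) = 2 * (X * Y - (a * c + b * d)).
  by rewrite -subr_sqr Z2 sqrrD X2 Y2; ring.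
apply: (@le_trans _ _ (2 * (e ^+ 2 * (X * Y)))); first by rewrite ler_pM2l.
have := mulr_ge0 (sqr_ge0 e) (sqr_ge0 (X - Y)).
have := mulr_ge0 (sqr_ge0 e) (ltW XY0).
have := mulr_ge0 (sqr_ge0 e) (sqr_ge0 (X + Y)).
lra.
Qed.

Lemma hypD_double_cone a b c d e : `|b| <= `|a| -> `|d| <= `|c| ->
    (0 < a) = (0 < c) -> `|b / a - d / c| <= e ->
  hyp a b + hyp c d <= hyp (a + c) (b + d) + e ^+ 2 * (hyp a b + hyp c d).
Proof.
move=> ba dc ac se.
have ge0 : 0 <= e ^+ 2 * (hyp a b + hyp c d).
  by rewrite mulr_ge0 ?sqr_ge0 ?addr_ge0 ?hyp_ge0.
have hyp00 : hyp 0 0 = 0 by rewrite /hyp expr0n addr0 sqrtr0.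
(* A vanishing dominant coordinate forces the zero vector, and then the norms add exactly. *)
have [a0|a0] := eqVneq a 0.
  move: ba ge0; rewrite a0 normr0 normr_le0 => /eqP ->.
  by rewrite hyp00 !add0r; lra.
have [c0|c0] := eqVneq c 0.
  move: dc ge0; rewrite c0 normr0 normr_le0 => /eqP ->.
  by rewrite hyp00 !addr0; lra.
have [pa|na] := ltP 0 a.
  have pc : 0 < c by rewrite -ac.
  by apply: hypD_cone => //; [rewrite -(gtr0_norm pa)|rewrite -(gtr0_norm pc)].
have pNa : 0 < - a by rewrite oppr_gt0 lt_neqAle a0.
have pNc : 0 < - c by rewrite oppr_gt0 lt_neqAle c0 leNgt -ac -leNgt.
rewrite -(hypN a) -(hypN c) -(hypN (a + c)) !opprD.
apply: hypD_cone => //; rewrite ?normrN.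
- by rewrite -(gtr0_norm pNa) normrN.
- by rewrite -(gtr0_norm pNc) normrN.
- by rewrite !invrN !mulrNN.
Qed.

(** Names the right-angled cone around a coordinate half-axis that contains [v]; within it, [slope]
    determines the direction. *)
Definition side (v : R * R) : bool * bool :=
  if `|v.2| <= `|v.1| then (true, 0 < v.1) else (false, 0 < v.2).

Definition slope (v : R * R) : R :=
  if `|v.2| <= `|v.1| then v.2 / v.1 else v.1 / v.2.

Lemma slope_bound v : `|slope v| <= 1.
Proof.
have aux (x y : R) : `|x| <= `|y| -> `|x / y| <= 1.
  have [->|y0] := eqVneq y 0; first by rewrite invr0 mulr0 normr0 ler01.
  by rewrite normrM normfV ler_pdivrMr ?normr_gt0 // mul1r.
rewrite /slope; case: ifPn => [|h]; apply: aux => //.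
by rewrite ltW // ltNge.
Qed.

Lemma hypD_side v w e : side v = side w -> `|slope v - slope w| <= e ->
  hyp v.1 v.2 + hyp w.1 w.2 <=
  hyp (v.1 + w.1) (v.2 + w.2) + e ^+ 2 * (hyp v.1 v.2 + hyp w.1 w.2).
Proof.
rewrite /side /slope; case: ifPn => hv; case: ifPn => hw // -[eqs].
  exact: hypD_double_cone.
rewrite (hypC v.1) (hypC w.1) (hypC (v.1 + w.1)).
by apply: hypD_double_cone => //; rewrite ltW // ltNge.
Qed.

(* Each of the four sides is cut into [2 k + 1] ranges of slopes of width
   [1 / k]. *)
Definition direction_class (k : nat) (v : R * R) : bool * bool * 'I_(k.*2.+1) :=
  (side v, inord (Num.trunc (k%:R * (slope v + 1)))).

Lemma hypD_direction_class k v w : (0 < k)%N ->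
    direction_class k v = direction_class k w ->
  hyp v.1 v.2 + hyp w.1 w.2 <=
  hyp (v.1 + w.1) (v.2 + w.2) + k%:R ^- 2 * (hyp v.1 v.2 + hyp w.1 w.2).
Proof.
move=> k0 [svw] /(congr1 val) /=.
have kR : 0 < k%:R :> R by rewrite ltr0n.
have bnd u : 0 <= k%:R * (slope u + 1) <= (k.*2)%:R.
  have := slope_bound u; rewrite ler_norml => /andP[h1 h2].
  rewrite mulr_ge0 ?(ltW kR) -?muln2 ?natrM ?ler_pM2l //; lra.
(* The value [2 k] is reached at slope [1], whence [2 k + 1] ranges. *)
have trb u : (Num.trunc (k%:R * (slope u + 1)) < k.*2.+1)%N.
  have /andP[h1 h2] := bnd u; have /andP[h3 _] := truncn_itv h1.
  by rewrite ltnS -(ler_nat R) (le_trans h3).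
rewrite !inordK // => eqt; rewrite -exprVn; apply: hypD_side => //.
have /andP[v0 _] := bnd v; have /andP[w0 _] := bnd w.
have := truncn_itv v0; have := truncn_itv w0; rewrite eqt -natr1.
set m := (Num.trunc _)%:R => /andP[h1 h2] /andP[h3 h4].
have : `|k%:R * (slope v - slope w)| <= 1.
  by rewrite ler_norml; apply/andP; split; lra.
by rewrite normrM (gtr0_norm kR) mulrC -ler_pdivlMr // mul1r.
Qed.

End Plane.

(** * Pairwise intersecting disks *)

Section Center.
Variable R : realType.
Implicit Types (c v : R * R).

(** Otherwise the three vectors would wind around the origin, and the angle between [u] and [w], the
    largest of the three, would be at least 120 degrees. *)
Lemma bisector_dot_gt0 (u w z : R * R) :
    u.1 ^+ 2 + u.2 ^+ 2 = 1 -> w.1 ^+ 2 + w.2 ^+ 2 = 1 ->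
    z.1 ^+ 2 + z.2 ^+ 2 = 1 ->
    - 1 < 2 * (u.1 * w.1 + u.2 * w.2) ->
    u.1 * w.1 + u.2 * w.2 <= u.1 * z.1 + u.2 * z.2 ->
    u.1 * w.1 + u.2 * w.2 <= w.1 * z.1 + w.2 * z.2 ->
  0 < (u.1 + w.1) * z.1 + (u.2 + w.2) * z.2.
Proof.
case: u w z => [u1 u2] [w1 w2] [z1 z2] /= nu nw nz.
set q := u1 * w1 + u2 * w2 => q12 zu zw.
rewrite ltNge; apply/negP => a0.
set a := (u1 + w1) * z1 + (u2 + w2) * z2 in a0.
set b := (u1 - w1) * z1 + (u2 - w2) * z2.
have zuE : u1 * z1 + u2 * z2 = (a + b) / 2 by rewrite /a /b; field.
have zwE : w1 * z1 + w2 * z2 = (a - b) / 2 by rewrite /a /b; field.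
(* The squared norm of [z] in the orthogonal frame [u + w], [u - w], cleared of denominators. *)
have gram : a ^+ 2 * (1 - q) + b ^+ 2 * (1 + q) = 2 * (1 - q ^+ 2).
  have sE : (u1 + w1) ^+ 2 + (u2 + w2) ^+ 2 = 2 * (1 + q) by rewrite /q; nra.
  have dE : (u1 - w1) ^+ 2 + (u2 - w2) ^+ 2 = 2 * (1 - q) by rewrite /q; nra.
  have sd : (u1 + w1) * (u1 - w1) + (u2 + w2) * (u2 - w2) = 0 by nra.
  have : a ^+ 2 * ((u1 - w1) ^+ 2 + (u2 - w2) ^+ 2)
      + b ^+ 2 * ((u1 + w1) ^+ 2 + (u2 + w2) ^+ 2)
      - 2 * a * b * ((u1 + w1) * (u1 - w1) + (u2 + w2) * (u2 - w2)) =
    (z1 ^+ 2 + z2 ^+ 2) * (((u1 + w1) ^+ 2 + (u2 + w2) ^+ 2)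
        * ((u1 - w1) ^+ 2 + (u2 - w2) ^+ 2)
      - ((u1 + w1) * (u1 - w1) + (u2 + w2) * (u2 - w2)) ^+ 2).
    by rewrite /a /b; ring.
  rewrite sd sE dE nz; lra.
have ab : a ^+ 2 + b ^+ 2 <= 4 * q ^+ 2.
  have h1 : 0 <= a + b - 2 * q by lra.
  have h2 : 0 <= a - b - 2 * q by lra.
  by have [b0|/ltW b0] := leP 0 b; nra.
have q0 : q <= 0 by lra.
have b2 : 0 <= - q * b ^+ 2 by rewrite mulr_ge0 ?oppr_ge0 ?sqr_ge0.
have : (a ^+ 2 + b ^+ 2) * (1 - q) <= 4 * q ^+ 2 * (1 - q).
  by rewrite ler_wpM2r //; lra.
have q1 : 0 < 1 - q by lra.
(* The second factor is [(1 - q) (1 + 2 q)]. *)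
have : 0 < (1 - q) * (1 + q - 2 * q ^+ 2) by rewrite mulr_gt0 //; nra.
lra.
Qed.

(** The sublevel set at [f c0] lies in a compact box around [c0], so a minimum over the box is
    global. *)
Lemma coercive_has_min (f : R * R -> R) c0 (M : R) : continuous f -> 0 <= M ->
    (forall c, f c <= f c0 -> `|c.1 - c0.1| <= M /\ `|c.2 - c0.2| <= M) ->
  exists c1, forall c, f c1 <= f c.
Proof.
move=> cf M0 coer.
pose A := `[c0.1 - M, c0.1 + M]%classic `*` `[c0.2 - M, c0.2 + M]%classic.
have inA c : `|c.1 - c0.1| <= M /\ `|c.2 - c0.2| <= M -> A c.
  by move=> [h1 h2]; split; rewrite /= in_itv /= -ler_distlC distrC.
have A0 : A c0 by apply: inA; rewrite !subrr normr0.
have cA : compact A by apply: compact_setX; exact: segment_compact.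
have [||c1 _ cmin] := @compact_EVT_min _ _ f A _ cA.
- by exists c0.
- exact: continuous_subspaceT.
exists c1 => c; have [le_c|/ltW] := leP (f c) (f c0).
  by apply: cmin; rewrite inE; apply/inA/coer.
by apply: le_trans; apply: cmin; rewrite inE.
Qed.

Lemma continuous_bigmax (T : topologicalType) (I : Type) (s : seq I)
    (f : I -> T -> R) : (forall i, continuous (f i)) ->
  continuous (fun x => \big[Num.max/0]_(i <- s) f i x).
Proof.
move=> cf x; elim: s => [|i s IHs].
  by under eq_fun do rewrite big_nil; exact: cvg_cst.
under eq_fun do rewrite big_cons.
apply: (@continuous2_cvg _ _ _ _ _ _ (f i) _ Num.max) => //.
- exact: (@max_continuous _ R (f i x, _)).
- exact: cf.
Qed.

Lemma continuous_edist (p : R * R) : continuous (fun c => dist c p).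
Proof.
move=> c; rewrite /Defs.edist.
apply: (@continuous_comp _ _ _ (fun c : R * R => (c.1 - p.1) ^+ 2 + (c.2 - p.2) ^+ 2));
  last exact: sqrt_continuous.
have sqr_cvg (g : R * R -> R) (l : R) : g x @[x --> c] --> l ->
    g x ^+ 2 @[x --> c] --> l ^+ 2.
  by move=> h; under eq_fun do rewrite expr2; rewrite expr2; apply: cvgM.
apply: cvgD; apply: sqr_cvg; apply: cvgB;
  [exact: cvg_fst|exact: cvg_cst|exact: cvg_snd|exact: cvg_cst].
Qed.

(** Moving by [t v] changes the squared distance by [t (t |v|^2 - 2 w.v)]. For small [t > 0] this is
    negative in the tight case and smaller than the slack otherwise. *)
Lemma descent_step (w v : R * R) (rho : R) :
    hyp w.1 w.2 <= rho -> (hyp w.1 w.2 = rho -> 0 < w.1 * v.1 + w.2 * v.2) ->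
  \forall t \near 0^'+, hyp (t * v.1 - w.1) (t * v.2 - w.2) < rho.
Proof.
move=> le_rho act; set D := w.1 * v.1 + w.2 * v.2 in act *.
set V := v.1 ^+ 2 + v.2 ^+ 2; have V0 : 0 <= V by rewrite addr_ge0 ?sqr_ge0.
have rho0 : 0 <= rho by apply: le_trans le_rho; exact: hyp_ge0.
suff key : \forall t \near 0^'+,
    t * (t * V - 2 * D) < rho ^+ 2 - hyp w.1 w.2 ^+ 2.
  near=> t; rewrite -(@ltr_pXn2r _ 2) ?nnegrE ?hyp_ge0 // sqr_hyp.
  suff : t * (t * V - 2 * D) < rho ^+ 2 - hyp w.1 w.2 ^+ 2.
    by rewrite sqr_hyp /V /D; lra.
  by near: t.
move: le_rho; rewrite le_eqVlt => /orP[/eqP eq_rho|lt_rho].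
  have D0 := act eq_rho; rewrite eq_rho subrr.
  near=> t.
  have t0 : 0 < t by near: t; exact: nbhs_right_gt.
  have tT : t < D / (V + 1) by near: t; apply: nbhs_right_lt; rewrite divr_gt0 //; lra.
  have {}tT : t * (V + 1) < D by rewrite -ltr_pdivlMr //; lra.
  rewrite pmulr_rlt0 //; lra.
set g := rho ^+ 2 - _; have g0 : 0 < g.
  by rewrite subr_gt0 ltr_pXn2r ?nnegrE ?hyp_ge0.
have S0 : 0 < V + 2 * `|D| + 1 by have := normr_ge0 D; lra.
near=> t.
have t0 : 0 < t by near: t; exact: nbhs_right_gt.
have t1 : t < 1 by near: t; exact: nbhs_right_lt.
have tT : t < g / (V + 2 * `|D| + 1) by near: t; apply: nbhs_right_lt; rewrite divr_gt0.
have {}tT : t * (V + 2 * `|D| + 1) < g by rewrite -ltr_pdivlMr.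
apply: le_lt_trans tT; rewrite ler_pM2l //.
have : t * V <= V by rewrite ler_piMl // ltW.
have := ler_norm (- D); rewrite normrN; lra.
Unshelve. all: by end_near.
Qed.

(** At a minimiser [c] of the largest ratio [dist c (p i) / r i], a ratio above [2 / sqrt 3] is
    contradicted either by two disks too far apart or by a direction of descent. *)
Lemma scaled_disks_have_common_point (I : finType) (p : I -> R * R)
    (r : I -> R) : (forall i j, dist (p i) (p j) <= r i + r j) ->
  exists c, forall i, dist c (p i) <= 2 / Num.sqrt 3 * r i.
Proof.
move=> rd.
have s3 : 0 < Num.sqrt (3 : R) by rewrite sqrtr_gt0.
have s3sq : Num.sqrt (3 : R) ^+ 2 = 3 by rewrite sqr_sqrtr.
have r0 i : 0 <= r i.
  by have := le_trans (hyp_ge0 _ _) (rd i i); lra.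
have k1 : 1 <= 2 / Num.sqrt 3 :> R.
  rewrite ler_pdivlMr // mul1r -(@ler_pXn2r _ 2) ?nnegrE ?ltW // s3sq; lra.
(* A disk of radius zero has its centre in all the others. *)
have [i0 ri0|r_neq0] := pickP (fun i => r i == 0).
  exists (p i0) => i; apply: (le_trans (rd i0 i)).
  by rewrite (eqP ri0) add0r ler_peMl.
have {}r0 i : 0 < r i by rewrite lt_neqAle eq_sym r_neq0 /=.
have [i0 _|noI] := pickP (xpredT : pred I); last first.
  by exists 0 => i; have := noI i.
pose F c := \big[Num.max/0]_i (dist c (p i) / r i).
have F_ge c i : dist c (p i) <= F c * r i.
  by rewrite -ler_pdivrMr //; exact: (le_bigmax _ (fun i => _ / r i)).
have F_cont : continuous F.
  apply: continuous_bigmax => i c; apply: cvgM; last exact: cvg_cst.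
  exact: continuous_edist.
have F0 c : 0 <= F c.
  have := F_ge c i0; have := hyp_ge0 (c.1 - (p i0).1) (c.2 - (p i0).2).
  by move=> h1 h2; have := le_trans h1 h2; rewrite pmulr_lge0.
have [||c cmin] := @coercive_has_min F (p i0) (F (p i0) * r i0) F_cont.
- by rewrite mulr_ge0 // ltW.
- move=> c lec.
  have cM : dist c (p i0) <= F (p i0) * r i0.
    by apply: (le_trans (F_ge _ _)); rewrite ler_pM2r.
  split; apply: le_trans cM.
    exact: (le_hyp_l (c.1 - (p i0).1) (c.2 - (p i0).2)).
  have := le_hyp_l (c.2 - (p i0).2) (c.1 - (p i0).1).
  by rewrite hypC.
exists c.
have [Fc i|Fc] := leP (F c) (2 / Num.sqrt 3).
  by apply: (le_trans (F_ge _ _)); rewrite ler_pM2r.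
exfalso.
have Fpos : 0 < F c by apply: lt_trans Fc; lra.
pose active i := dist c (p i) == F c * r i.
have [i1 act1] : exists i, active i.
  have [//||i _] := @eq_bigmax _ _ _ 0 i0 predT (fun i => dist c (p i) / r i).
  - by move=> i _; rewrite divr_ge0 ?hyp_ge0 // ltW.
  rewrite -/(F c) => FE; exists i; rewrite /active FE divfK // gt_eqF //.
pose u i : R * R := (((p i).1 - c.1) / dist c (p i), ((p i).2 - c.2) / dist c (p i)).
have dist_gt0 i : active i -> 0 < dist c (p i).
  by move=> /eqP ->; rewrite mulr_gt0.
have distE i : dist c (p i) ^+ 2 = ((p i).1 - c.1) ^+ 2 + ((p i).2 - c.2) ^+ 2.
  by rewrite sqr_hyp; ring.
have u_unit i : active i -> (u i).1 ^+ 2 + (u i).2 ^+ 2 = 1.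
  move=> /dist_gt0 h; rewrite /u /= !expr_div_n -mulrDl -distE divff //.
  by rewrite expf_neq0 // gt_eqF.
pose dot i j := (u i).1 * (u j).1 + (u i).2 * (u j).2.
(* Among the tight points, choose two seen from [c] under the largest angle. *)
pose Q (ij : I * I) := active ij.1 && active ij.2.
have Q1 : Q (i1, i1) by rewrite /Q /= act1.
case: (@arg_minP _ _ _ _ Q (fun ij => dot ij.1 ij.2) Q1) => -[i j] /andP[/= ai aj] ijmin.
(* At 120 degrees or more, the law of cosines makes the squared distance of the centres at least
   [F^2 (ri^2 + ri rj + rj^2)], hence at least [3/4 F^2 (ri + rj)^2]. *)
have [qle|qgt] := leP (2 * dot i j) (- 1).
  have pij : dist (p i) (p j) ^+ 2 = dist c (p i) ^+ 2 + dist c (p j) ^+ 2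
      - 2 * dot i j * (dist c (p i) * dist c (p j)).
    rewrite sqr_hyp !distE /dot /u /=.
    field; by rewrite !gt_eqF ?dist_gt0.
  have := rd i j; rewrite -(@ler_pXn2r _ 2) ?nnegrE ?hyp_ge0 ?addr_ge0 ?(ltW (r0 _)) //.
  apply/negP; rewrite -ltNge pij (eqP ai) (eqP aj).
  have F2 : 4 < 3 * F c ^+ 2.
    move: Fc; rewrite ltr_pdivrMr // -(@ltr_pXn2r _ 2) ?nnegrE ?mulr_ge0 ?(ltW s3) //.
    by rewrite exprMn s3sq; lra.
  have rr := mulr_gt0 (r0 i) (r0 j).
  have h1 : 0 <= (- 1 - 2 * dot i j) * (F c ^+ 2 * (r i * r j)).
    by rewrite mulr_ge0 ?subr_ge0 // mulr_ge0 ?sqr_ge0 // ltW.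
  have h2 : 0 < (3 * F c ^+ 2 - 4) * (r i + r j) ^+ 2.
    by rewrite mulr_gt0 ?subr_gt0 // exprn_gt0 ?addr_gt0.
  have h3 := mulr_ge0 (sqr_ge0 (F c)) (sqr_ge0 (r i - r j)).
  lra.
(* Below 120 degrees, moving [c] along the bisector brings it closer to every tight point. *)
pose v : R * R := ((u i).1 + (u j).1, (u i).2 + (u j).2).
have vpos k : active k -> 0 < v.1 * (u k).1 + v.2 * (u k).2.
  move=> ak; apply: bisector_dot_gt0; rewrite ?u_unit //.
    by apply: (ijmin (i, k)); rewrite /Q /= ai.
  by apply: (ijmin (j, k)); rewrite /Q /= aj.
pose w k : R * R := ((p k).1 - c.1, (p k).2 - c.2).
have distw k : hyp (w k).1 (w k).2 = dist c (p k).
  by rewrite /w /= -hypN !opprB.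
have /filter_ex[t tlt] : \forall t \near (0 : R)^'+,
    forall k, hyp (t * v.1 - (w k).1) (t * v.2 - (w k).2) < F c * r k.
  apply: filter_forall => k.
  apply: descent_step; rewrite distw // => /eqP ak.
  suff -> : (w k).1 * v.1 + (w k).2 * v.2 =
      (v.1 * (u k).1 + v.2 * (u k).2) * dist c (p k).
    by rewrite mulr_gt0 ?vpos ?dist_gt0.
  have d0 := dist_gt0 k ak.
  by move: v.1 v.2 => v1 v2; rewrite /w /u /=; field; rewrite gt_eqF.
have := cmin (c.1 + t * v.1, c.2 + t * v.2); apply/negP; rewrite -ltNge.
apply: bigmax_lt => // k _; rewrite ltr_pdivrMr //; apply: le_lt_trans (tlt k).
by rewrite /w /Defs.edist /hyp /= le_eqVlt; apply/orP; left; apply/eqP; congr Num.sqrt; ring.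
Qed.

End Center.

(** * Duality for the assignment problem *)

Section Potentials.
Variables (R : realType) (T : finType).
Implicit Types (c d : T -> T -> R) (x y z : T) (p q : seq T).

Fixpoint walk c x p : R := if p is y :: p' then c x y + walk c y p' else 0.

Lemma walk_cat c x p q : walk c x (p ++ q) = walk c x p + walk c (last x p) q.
Proof. by elim: p x => [|y p IHp] x /=; rewrite ?add0r // IHp addrA. Qed.

Lemma walk_rcons c x p y : walk c x (rcons p y) = walk c x p + c (last x p) y.
Proof. by rewrite -cats1 walk_cat /= addr0. Qed.

(** The permutation rotates the cycle; composing with [tperm x y] inserts [x] just before [y]. Fixed
    points are free because the diagonal of [c] vanishes. *)
Lemma simple_cycle_perm c x p : (forall i, c i i = 0) -> uniq (x :: p) ->
  exists t : {perm T}, [/\ t (last x p) = x, forall z, z \notin x :: p -> t z = z &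
    \sum_i c i (t i) = walk c x (rcons p x)].
Proof.
move=> c0; elim: p x => [|y p IHp] x.
  move=> _; exists 1%g; split=> [|z _|]; rewrite ?perm1 //.
  by rewrite /= c0 addr0 big1 // => i _; rewrite perm1 c0.
rewrite cons_uniq => /andP[xNp /IHp[t [tl tfix tsum]]].
have xNl : x != last y p by apply: contraNneq xNp => ->; exact: mem_last.
have tx : t x = x by exact: tfix.
exists (t * tperm x y)%g; split.
- by rewrite /= permM tl tpermR.
- move=> z; rewrite inE negb_or => /andP[zx zp].
  by rewrite permM tfix // tpermD // eq_sym //; move: zp; rewrite inE negb_or => /andP[].
rewrite (bigD1 x) //= (bigD1 (last y p)) /=; last by rewrite eq_sym.
rewrite !permM tx tl tpermL tpermR.
have -> : \sum_(i | (i != x) && (i != last y p)) c i ((t * tperm x y)%g i) =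
          \sum_(i | (i != x) && (i != last y p)) c i (t i).
  apply: eq_bigr => i /andP[ix il]; rewrite permM tpermD //.
    by rewrite -tx (inj_eq perm_inj) eq_sym.
  by rewrite -tl (inj_eq perm_inj) eq_sym.
move: tsum; rewrite (bigD1 x) //= (bigD1 (last y p)) /=; last by rewrite eq_sym.
by rewrite tx tl c0 !walk_rcons; lra.
Qed.

(** * Longest walks in a weighted graph without positive cycles *)

Section NoPositiveCycle.
Variable c : T -> T -> R.
Hypothesis cycle_le0 : forall x p, uniq (x :: p) -> walk c x (rcons p x) <= 0.

(** Cutting out a closed piece removes a nonpositive weight. *)
Lemma walk_le_simple_walk x p :
  exists2 q, uniq (x :: q) & walk c x p <= walk c x q.
Proof.
elim: p x => [|y p IHp] x; first by exists [::].
have [q uq leq] := IHp y.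
have [xq|xNq] := boolP (x \in y :: q); last first.
  by exists (y :: q); rewrite ?cons_uniq ?xNq //= lerD2l.
have {leq} : walk c x (y :: p) <= walk c x (y :: q) by rewrite /= lerD2l.
case/splitPr: xq uq => q1 q2; rewrite uniq_catC cat_uniq => /and3P[uq2 hq uq1].
have uxq1 : uniq (x :: q1).
  by rewrite cons_uniq uq1 andbT; apply: contra hq => xq1; apply/hasP; exists x; rewrite ?mem_head.
rewrite -cat_rcons walk_cat last_rcons => le1; exists q2 => //.
by apply: (le_trans le1); rewrite gerDr cycle_le0.
Qed.

Lemma walk_bounded : exists M, forall x p, walk c x p <= M.
Proof.
pose C := \sum_i \sum_j `|c i j|.
have cC i j : c i j <= C.
  apply: (le_trans (ler_norm _)); rewrite /C (bigD1 i) //= (bigD1 j) //=.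
  by rewrite -addrA lerDl addr_ge0 ?sumr_ge0 // => k _; rewrite ?sumr_ge0.
have C0 : 0 <= C by rewrite sumr_ge0 // => i _; rewrite sumr_ge0.
exists (#|T|%:R * C) => x p; have [q uq /le_trans->//] := walk_le_simple_walk x p.
have : (size q <= #|T|)%N.
  by rewrite ltnW // -[(size q).+1]/(size (x :: q)) -(card_uniqP uq) max_card.
rewrite -(ler_nat R) => /(ler_wpM2r C0); apply: le_trans.
elim: q x {uq} => [|y q IHq] x /=; first by rewrite mul0r.
by rewrite -natr1 mulrDl mul1r addrC lerD.
Qed.

(** The potential of [k] is the supremum of the weights of walks from a fixed [x0] to [k]; appending
    an edge gives the inequality. *)
Lemma cycle_potential : exists y : T -> R, forall i k, y i + c i k <= y k.
Proof.
have [x0 _|noT] := pickP (xpredT : pred T); last first.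
  by exists (fun=> 0) => i; have := noT i.
have [M leM] := walk_bounded.
pose A k := [set walk c x0 p | p in [set p | last x0 p = k]].
have A0 k : A k !=set0 by exists (walk c x0 [:: k]); exists [:: k].
have hA k : has_sup (A k) by split=> //; exists M => _ [p _ <-].
exists (fun k => sup (A k)) => i k; rewrite -lerBrDr; apply: ge_sup => // _ [p pi <-].
rewrite lerBrDr; apply: ub_le_sup; first exact: (hA k).2.
by exists (rcons p k); rewrite /= ?last_rcons // walk_rcons pi.
Qed.

End NoPositiveCycle.

(** Let [c i k] be the gain from sending [i] to [s k] instead of [s i]. Optimality of [s] excludes
    cycles of positive gain, and a potential for [c] yields the dual variables, with complementary
    slackness along [s]. *)
Lemma assignment_duality d (s : {perm T}) :
    (forall t : {perm T}, \sum_i d i (t i) <= \sum_i d i (s i)) ->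
  exists u v : T -> R, (forall i j, d i j <= u i + v j) /\
    forall i, u i + v (s i) = d i (s i).
Proof.
move=> opt; pose c i k := d i (s k) - d i (s i).
have [|y yP] := @cycle_potential c.
  move=> x p /(@simple_cycle_perm c)[i|t [_ _ <-]]; first by rewrite /c subrr.
  have := opt (t * s)%g; rewrite -subr_le0 -sumrB.
  by under eq_bigr do rewrite permM.
exists (fun i => d i (s i) - y i), (fun j => y (s^-1%g j)); split=> [i j|i].
  by have := yP i (s^-1%g j); rewrite /c permKV; lra.
by rewrite permK subrK.
Qed.

End Potentials.

(** * From an assignment to a tour *)

Section Assignment.
Variables (R : realType) (T : finType) (P : T -> R * R).
Implicit Types (s t : {perm T}) (a b : T).

Definition cost s : R := \sum_i dist (P i) (P (s i)).

Definition step s i : R * R := ((P (s i)).1 - (P i).1, (P (s i)).2 - (P i).2).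

Lemma distC (p q : R * R) : dist p q = dist q p.
Proof. by rewrite /Defs.edist -sqrrN opprB -[X in _ + X]sqrrN opprB. Qed.

Lemma dist_step s i : dist (P i) (P (s i)) = hyp (step s i).1 (step s i).2.
Proof. by rewrite distC. Qed.

Lemma cost_ge2 s a b : a != b ->
  dist (P a) (P (s a)) + dist (P b) (P (s b)) <= cost s.
Proof.
move=> ab; rewrite /cost (bigD1 a) //= (bigD1 b) /=; last by rewrite eq_sym.
by rewrite lerD2l lerDl sumr_ge0 // => i _; exact: hyp_ge0.
Qed.

(** The two new displacements have the same sum as the two old ones. *)
Lemma cost_swap s a b : a != b ->
  cost s + hyp ((step s a).1 + (step s b).1) ((step s a).2 + (step s b).2) <=
  cost (tperm a b * s)%g
  + (hyp (step s a).1 (step s a).2 + hyp (step s b).1 (step s b).2).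
Proof.
move=> ab; have ba : b != a by rewrite eq_sym.
rewrite -!dist_step /cost (bigD1 a) //= (bigD1 b) //=.
rewrite [X in _ <= X + _](bigD1 a) //= [X in _ <= _ + X + _](bigD1 b) //=.
rewrite !permM tpermL tpermR.
have -> : \sum_(i | (i != a) && (i != b)) dist (P i) (P ((tperm a b * s)%g i)) =
          \sum_(i | (i != a) && (i != b)) dist (P i) (P (s i)).
  by apply: eq_bigr => i /andP[ia ib]; rewrite permM tpermD // eq_sym.
have : hyp ((step s a).1 + (step s b).1) ((step s a).2 + (step s b).2) <=
    dist (P a) (P (s b)) + dist (P b) (P (s a)).
  rewrite (distC (P a)) (distC (P b)); apply: le_trans (hypD _ _ _ _).
  by rewrite /step /= le_eqVlt; apply/orP; left; apply/eqP; congr hyp; ring.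
lra.
Qed.

Lemma card_porbits_swap s a b : porbit s a != porbit s b ->
  #|porbits (tperm a b * s)%g|.+1 = #|porbits s|.
Proof.
move=> ab; have := porbits_mul_tperm s a b.
rewrite -eq_porbit_mem ab /= (contra_neq _ ab); last by move=> ->.
by rewrite addn1 addn2 => -[].
Qed.

(** Pigeonhole: there are [4 (2 k + 1)] direction classes, so two cycles have representatives in one
    class. *)
Lemma merge_parallel_cycles (k : nat) (W : R) s : (0 < k)%N ->
    (forall t, cost t <= W) -> (4 * k.*2.+1 < #|porbits s|)%N ->
  exists2 t, #|porbits t|.+1 = #|porbits s| & cost s <= cost t + W / k%:R ^+ 2.
Proof.
move=> k0 leW many.
have [x0 _|noT] := pickP (xpredT : pred T); last first.
  move: many; rewrite (_ : porbits s = finset.set0) ?cards0 //.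
  by apply/setP => A; rewrite inE; apply/negP => /imsetP[x]; have := noT x.
pose rep (A : {set T}) := odflt x0 [pick x in A].
have repP A : A \in porbits s -> porbit s (rep A) = A.
  case/imsetP => x _ ->; rewrite /rep; case: pickP => [y|/(_ x)].
    by rewrite -eq_porbit_mem => /eqP.
  by rewrite porbit_id.
pose f A := direction_class k (step s (rep A)).
have : ~~ dinjectiveb f (mem (porbits s)).
  apply: contraL many => /dinjectiveP /card_in_imset <-; rewrite -leqNgt.
  by apply: (leq_trans (max_card _)); rewrite !card_prod !card_bool card_ord.
case/dinjectivePn => A Ain [B]; rewrite !inE => /andP[BA Bin] fAB.
set a := rep A; set b := rep B.
have ab : porbit s a != porbit s b by rewrite !repP // eq_sym.
have aNb : a != b by apply: contra_neq ab => ->.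
exists (tperm a b * s)%g; first exact: card_porbits_swap.
have := cost_swap s aNb; have := hypD_direction_class k0 fAB.
have kinv : 0 <= k%:R ^- 2 :> R by rewrite invr_ge0 exprn_ge0.
have := ler_wpM2l kinv (le_trans (cost_ge2 s aNb) (leW s)).
rewrite !dist_step (mulrC W) /a /b; lra.
Qed.

Lemma merge_at_shortest_edge (W : R) s : cost s <= W -> (1 < #|porbits s|)%N ->
  exists2 t, #|porbits t|.+1 = #|porbits s| & cost s <= cost t + 2 * W / #|T|%:R.
Proof.
move=> leW /card_gt1P[A [B [/imsetP[x0 _ Ax] /imsetP[y0 _ By] AB]]].
have T0 : 0 < #|T|%:R :> R by rewrite ltr0n; apply/card_gt0P; exists x0.
case: (@arg_minP _ _ _ x0 xpredT (fun i => dist (P i) (P (s i))) isT) => a _ amin.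
have aW : dist (P a) (P (s a)) <= W / #|T|%:R.
  rewrite ler_pdivlMr //; apply: le_trans leW.
  by rewrite mulr_natr -sumr_const; apply: ler_sum => i _; exact: amin.
have [b ab] : exists b, porbit s a != porbit s b.
  have [ax|ax] := eqVneq (porbit s a) (porbit s x0); last by exists x0.
  by exists y0; rewrite ax -Ax -By.
have aNb : a != b by apply: contra_neq ab => ->.
exists (tperm a b * s)%g; first exact: card_porbits_swap.
have := cost_swap s aNb; rewrite -mulrA; move: aW; rewrite dist_step.
(* Writing [y = (x + y) + (- x)] bounds the loss by [2 |x|], where [x] is the shortest
   displacement. *)
have := hypD ((step s a).1 + (step s b).1) ((step s a).2 + (step s b).2)
             (- (step s a).1) (- (step s a).2).
by rewrite hypN (addrAC (step s a).1) (addrAC (step s a).2) !subrr !add0r; lra.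
Qed.

Lemma merge_down_to (N : nat) (e : R) : 0 <= e ->
    (forall s, (N < #|porbits s|)%N ->
      exists2 t, #|porbits t|.+1 = #|porbits s| & cost s <= cost t + e) ->
  forall s, exists2 t, (#|porbits t| <= N)%N & cost s <= cost t + #|porbits s|%:R * e.
Proof.
move=> e0 step s; have [m] := ubnP #|porbits s|.
elim: m s => // m IHm s; rewrite ltnS => le_m.
have [leN|ltN] := leqP #|porbits s| N.
  by exists s => //; rewrite lerDl mulr_ge0.
have [t tE cst] := step s ltN.
have [|t' t'N ct] := IHm t; first by rewrite tE.
by exists t' => //; rewrite -tE -natr1 mulrDl mul1r; lra.
Qed.

(** The first stage makes at most [#|T|] merges, the second at most [4 (2 k + 1)], each of these
    losing [2 cost s / #|T|]; this gives [16 k + 8]. *)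
Lemma merge_into_one_cycle (k : nat) (s : {perm T}) : (0 < k)%N ->
    (forall t, cost t <= cost s) ->
  exists2 t, (#|porbits t| <= 1)%N &
    cost s <= cost t + cost s * (#|T|%:R / k%:R ^+ 2 + (16 * k + 8)%:R / #|T|%:R).
Proof.
move=> k0 opt.
have W0 : 0 <= cost s by rewrite sumr_ge0 // => i _; exact: hyp_ge0.
have e1 : 0 <= cost s / k%:R ^+ 2 by rewrite divr_ge0 ?exprn_ge0.
have e2 : 0 <= 2 * cost s / #|T|%:R by rewrite divr_ge0 ?mulr_ge0.
have [t tN st] := merge_down_to e1 (fun s' => @merge_parallel_cycles k _ s' k0 opt) s.
have [t' t'1 tt'] := merge_down_to e2 (fun s' => @merge_at_shortest_edge _ s' (opt s')) t.
exists t' => //.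
have h1 : #|porbits s|%:R * (cost s / k%:R ^+ 2) <= #|T|%:R * (cost s / k%:R ^+ 2).
  by rewrite ler_wpM2r // ler_nat; apply: leq_imset_card.
have h2 : #|porbits t|%:R * (2 * cost s / #|T|%:R) <=
    (4 * k.*2.+1)%:R * (2 * cost s / #|T|%:R).
  by rewrite ler_wpM2r // ler_nat.
have -> : cost s * (#|T|%:R / k%:R ^+ 2 + (16 * k + 8)%:R / #|T|%:R) =
   #|T|%:R * (cost s / k%:R ^+ 2) + (4 * k.*2.+1)%:R * (2 * cost s / #|T|%:R).
  have -> : (16 * k + 8)%:R = 16 * k%:R + 8 :> R by rewrite natrD natrM.
  have -> : (4 * k.*2.+1)%:R = 8 * k%:R + 4 :> R.
    by rewrite mulnS -mul2n mulnA addnC natrD natrM.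
  by ring.
lra.
Qed.

End Assignment.

(** * Tours and Fermat-Weber values compared with assignments *)

Section Tour.
Variable R : realType.

(** The iterates of [s] from [ord0] list the points in the order of a tour. The bound [<= 1] covers
    [n = 0], where there is no cycle. *)
Lemma cost_le_MTSP n (P : 'I_n -> R * R) (s : {perm 'I_n}) :
  (#|porbits s| <= 1)%N -> cost P s <= MTSP P.
Proof.
case: n P s => [|n] P s s1.
  by rewrite /cost big_ord0 /MTSP; exact: bigmax_ge_id.
have orb x : porbit s ord0 = porbit s x.
  by apply: (card_le1_eqP s1); apply: imset_f.
have orbT : #|porbit s ord0| = n.+1.
  rewrite -[RHS]card_ord; apply: eq_card => x.
  by rewrite inE (orb x) porbit_id.
pose f (i : 'I_n.+1) := iter i s ord0.
have f_inj : injective f.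
  move=> i j; rewrite /f -!(nth_traject s (ltn_ord _)) => /eqP.
  have := uniq_traject_porbit s ord0; rewrite orbT => uq.
  by rewrite nth_uniq ?size_traject // => /eqP /val_inj.
have fS i : f (ordS i) = s (f i).
  rewrite /f /=; have [->|ni] := eqVneq (i : nat) n.
    by rewrite modnn; have := iter_porbit s ord0; rewrite orbT => /esym.
  rewrite modn_small //.
  by rewrite ltn_neqAle eqSS ni ltn_ord.
suff -> : cost P s = tour_length P (perm f_inj).
  exact: (le_bigmax _ (tour_length P)).
rewrite /cost (reindex_inj (@perm_inj _ (perm f_inj))).
by apply: eq_bigr => i _; rewrite !permE fS.
Qed.

Lemma FWP_le_cost n (P : 'I_n -> R * R) (s : {perm 'I_n}) :
  (forall t, cost P t <= cost P s) -> FWP P <= cost P s / Num.sqrt 3.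
Proof.
move=> /(@assignment_duality _ _ (fun i j => dist (P i) (P j)))[u [v [uv uvs]]].
(* Averaging the dual constraints for [(i, j)] and [(j, i)] gives symmetric radii. *)
have [|c cP] := @scaled_disks_have_common_point R _ P (fun i => (u i + v i) / 2).
  by move=> i j; have := uv i j; have := uv j i; rewrite (distC (P j)); lra.
have sumE : \sum_i ((u i + v i) / 2) = cost P s / 2.
  rewrite -mulr_suml big_split /= [X in _ + X](reindex_inj (@perm_inj _ s)).
  by rewrite -big_split /=; under eq_bigr do rewrite uvs.
apply: (@le_trans _ _ (\sum_i dist c (P i))).
  apply: ge_inf; last by exists c.
  by exists 0 => _ [c' _ <-]; rewrite sumr_ge0 // => i _; exact: hyp_ge0.
apply: (@le_trans _ _ (\sum_i 2 / Num.sqrt 3 * ((u i + v i) / 2))).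
  by apply: ler_sum => i _.
rewrite -mulr_sumr sumE; lra.
Qed.

End Tour.

(** * The two bounds *)

Section Bounds.
Variable R : realType.

Lemma ratio_le n k (P : 'I_n -> R * R) (d : R) : (0 < k)%N -> d < 1 ->
    n%:R / k%:R ^+ 2 + (16 * k + 8)%:R / n%:R <= d -> 0 < MTSP P ->
  2 * FWP P / MTSP P <= 2 / Num.sqrt 3 / (1 - d).
Proof.
move=> k0 d1 le_d M0.
have s3 : 0 < Num.sqrt (3 : R) by rewrite sqrtr_gt0.
case: (@Order.TotalTheory.arg_maxP _ _ _ 1%g xpredT (cost P) isT) => s _ smax.
have {}smax t : cost P t <= cost P s by exact: smax.
have [t t1] := merge_into_one_cycle k0 smax; rewrite card_ord => st.
have W0 : 0 <= cost P s by rewrite sumr_ge0 // => i _; exact: hyp_ge0.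
have tM := cost_le_MTSP P t1.
have WM : cost P s * (1 - d) <= MTSP P by have := ler_wpM2l W0 le_d; lra.
have WM' : cost P s <= MTSP P / (1 - d) by rewrite ler_pdivlMr ?subr_gt0.
have := FWP_le_cost smax; rewrite ler_pdivrMr //.
have i3 : 0 <= (Num.sqrt 3)^-1 :> R by rewrite invr_ge0 ltW.
have := ler_wpM2r i3 WM'; lra.
Qed.

Lemma merging_loss_small (d : R) : 0 < d ->
  \forall n \near \oo, exists2 k, (0 < k)%N &
    n%:R / k%:R ^+ 2 + (16 * k + 8)%:R / n%:R <= d.
Proof.
(* With [e n < k <= e n + 1] the sum is at most [16 e + (24 + e^-2) / n]; here [16 e = d / 2], and
   the rest is at most [d / 2] for large [n]. *)
move=> d0; set e := d / 32; have e0 : 0 < e by rewrite divr_gt0.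
have A0 : 0 < 24 + e ^- 2 by rewrite addr_gt0 ?invr_gt0 ?exprn_gt0.
near=> n.
have n_big : 2 * (24 + e ^- 2) / d <= n%:R by near: n; exact: nbhs_infty_ger.
have n0 : 0 < n%:R :> R by apply: lt_le_trans n_big; rewrite divr_gt0 ?mulr_gt0.
have /truncn_itv /andP[h1 h2] : 0 <= e * n%:R by rewrite mulr_ge0 ?ltW.
exists (Num.trunc (e * n%:R)).+1 => //; move: h1 h2; set k := _.+1.
have -> : (Num.trunc (e * n%:R))%:R = k%:R - 1 :> R by rewrite /k -natr1 addrK.
move=> h1 h2.
have en0 : 0 < e * n%:R by rewrite mulr_gt0.
have kR0 : 0 < k%:R :> R by exact: lt_trans h2.
have b1 : n%:R / k%:R ^+ 2 <= e ^- 2 / n%:R.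
  apply: (@le_trans _ _ (n%:R / (e * n%:R) ^+ 2)).
    rewrite ler_pM2l // lef_pV2 ?posrE ?exprn_gt0 //.
    by rewrite ler_pXn2r ?nnegrE ?(ltW kR0) ?(ltW en0) // ltW.
  by rewrite le_eqVlt; apply/orP; left; apply/eqP; field; rewrite !gt_eqF.
have b2 : (16 * k + 8)%:R / n%:R <= 16 * e + 24 / n%:R.
  rewrite ler_pdivrMr // mulrDl divfK ?gt_eqF // natrD natrM; lra.
have b3 : (24 + e ^- 2) / n%:R <= d / 2.
  rewrite ler_pdivrMr //; move: n_big; rewrite ler_pdivrMr //; lra.
have eE : 16 * e = d / 2 by rewrite /e; lra.
lra.
Unshelve. all: by end_near.
Qed.

(** * Points spread over an equilateral triangle *)

Definition triangle (i : nat) : R * R :=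
  if i is 0%N then (0, 0) else if i is 1%N then (1, 0) else (2^-1, Num.sqrt 3 / 2).

Lemma dist_triangle i j : dist (triangle i) (triangle j) <= 1.
Proof.
have s3 : Num.sqrt (3 : R) ^+ 2 = 3 by rewrite sqr_sqrtr.
rewrite -(@ler_pXn2r _ 2) ?nnegrE ?hyp_ge0 // (sqr_hyp (_ - _)) expr1n.
by case: i j => [|[|i]] [|[|j]] /=; lra.
Qed.

(* The sum is at least the value at [c] of the sum of the linear forms given by
   the three unit vectors from the centroid to the vertices, which is constant. *)
Lemma sum_dist_triangle c :
  Num.sqrt 3 <= dist c (triangle 0) + dist c (triangle 1) + dist c (triangle 2).
Proof.
have s3 : Num.sqrt (3 : R) ^+ 2 = 3 by rewrite sqr_sqrtr.
have hyp1 (a b : R) : a ^+ 2 + b ^+ 2 = 1 -> hyp a b = 1.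
  by rewrite /hyp => ->; rewrite sqrtr1.
have u0 : hyp (Num.sqrt 3 / 2) 2^-1 = 1 :> R by apply: hyp1; lra.
have u1 : hyp (- (Num.sqrt 3 / 2)) 2^-1 = 1 :> R by apply: hyp1; lra.
have u2 : hyp 0 (- 1) = 1 :> R by apply: hyp1; lra.
have := dot_le_hyp (c.1 - 0) (c.2 - 0) (Num.sqrt 3 / 2) 2^-1.
have := dot_le_hyp (c.1 - 1) (c.2 - 0) (- (Num.sqrt 3 / 2)) 2^-1.
have := dot_le_hyp (c.1 - 2^-1) (c.2 - Num.sqrt 3 / 2) 0 (- 1).
rewrite u0 u1 u2 /Defs.edist -!/(hyp _ _) /=; lra.
Qed.

Lemma sum_mod3_ge (g : nat -> R) n : (forall i, 0 <= g i) ->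
  (n %/ 3)%:R * (g 0%N + g 1%N + g 2%N) <= \sum_(i < n) g (i %% 3)%N.
Proof.
move=> g0; rewrite -(big_mkord xpredT (fun i => g (i %% 3)%N)).
rewrite (@big_cat_nat _ _ _ (3 * (n %/ 3))) //=; last by rewrite mulnC leq_trunc_div.
rewrite -[leLHS]addr0 lerD ?sumr_ge0 // le_eqVlt; apply/orP; left; apply/eqP.
elim: (n %/ 3)%N => [|m IHm]; first by rewrite mul0r big_geq.
rewrite mulnS addnC addn3 !big_nat_recr //= -IHm -natr1.
have modE j : (j < 3)%N -> ((3 * m + j) %% 3 = j)%N.
  by move=> j3; rewrite mulnC modnMDl modn_small.
have := modE 0%N isT; have := modE 1%N isT; have := modE 2%N isT.
by rewrite addn2 addn1 addn0 => -> -> ->; ring.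
Qed.

(** No edge exceeds [1], so a tour has length at most [n], while each of the [n %/ 3] full triples
    adds at least [sqrt 3] to any sum of distances. *)
Lemma triangle_ratio n : (2 < n)%N ->
  exists P : 'I_n -> R * R, 0 < MTSP P /\
    2 / Num.sqrt 3 * (1 - 2 / n%:R) <= 2 * FWP P / MTSP P.
Proof.
move=> n2; exists (fun i : 'I_n => triangle (i %% 3)%N); set P := fun i => _.
have n0 : 0 < n%:R :> R by rewrite ltr0n (leq_trans _ n2).
have s3 : 0 < Num.sqrt (3 : R) by rewrite sqrtr_gt0.
have s3sq : Num.sqrt (3 : R) ^+ 2 = 3 by rewrite sqr_sqrtr.
have len_le s : tour_length P s <= n%:R.
  rewrite -[n in n%:R]card_ord -sumr_const; apply: ler_sum => i _.
  exact: dist_triangle.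
have MTSP_le : MTSP P <= n%:R by apply: bigmax_le => //; exact: ltW.
have MTSP_gt0 : 0 < MTSP P.
  apply: lt_le_trans (le_bigmax _ (tour_length P) 1%g).
  pose i0 := Ordinal (leq_trans (isT : 0 < 3)%N n2).
  rewrite /tour_length (bigD1 i0) //= ltr_pwDl //; last first.
    by rewrite sumr_ge0 // => i _; exact: hyp_ge0.
  rewrite !perm1 /P /= (@modn_small 1 n) ?(leq_trans _ n2) //= /Defs.edist /=.
  by rewrite sqrtr_gt0 subrr expr0n addr0 sub0r sqrrN expr1n.
have FWP_ge : Num.sqrt 3 * (n %/ 3)%:R <= FWP P.
  apply: lb_le_inf; first by exists (\sum_(i < n) dist (0, 0) (P i)); exists (0, 0).
  move=> _ [c _ <-].
  apply: le_trans (@sum_mod3_ge (fun i => dist c (triangle i)) n _); last first.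
    by move=> i; exact: hyp_ge0.
  by rewrite mulrC ler_wpM2l // sum_dist_triangle.
split=> //; rewrite ler_pdivlMr //.
have q_ge : n%:R - 2 <= 3 * (n %/ 3)%:R :> R.
  have : (n <= 3 * (n %/ 3) + 2)%N.
    by rewrite {1}(divn_eq n 3) mulnC leq_add2l -ltnS ltn_mod.
  by rewrite -(ler_nat R) natrD natrM; lra.
have q2 : 0 <= 1 - 2 / n%:R :> R by rewrite subr_ge0 ler_pdivrMr // mul1r ler_nat ltnW.
have k0 : 0 <= 2 / Num.sqrt 3 * (1 - 2 / n%:R) :> R by rewrite mulr_ge0 // divr_ge0 // ltW.
apply: (le_trans (ler_wpM2l k0 MTSP_le)).
have -> : 2 / Num.sqrt 3 * (1 - 2 / n%:R) * n%:R = 2 * Num.sqrt 3 * ((n%:R - 2) / 3) :> R.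
  by rewrite -[X in (_ - 2) / X]s3sq; field; rewrite !gt_eqF.
rewrite -mulrA ler_pM2l //; apply: le_trans FWP_ge; rewrite ler_pM2l //; lra.
Qed.

End Bounds.

Theorem theorem3 (R : realType) :
  (fun n : nat => r_n R n) @ \oo --> (2 / Num.sqrt 3 : R).
Proof.
set K : R := 2 / Num.sqrt 3.
have K0 : 0 < K by rewrite divr_gt0 // sqrtr_gt0.
apply/cvgrPdist_le => e e0.
(* Chosen so that [K / (1 - d) = K + e]. *)
set d := e / (K + e).
have Ke : 0 < K + e by rewrite addr_gt0.
have d0 : 0 < d by rewrite divr_gt0.
have d1 : d < 1 by rewrite ltr_pdivrMr //; lra.
have KdE : K / (1 - d) = K + e by rewrite /d; field; rewrite !gt_eqF //; lra.
near=> n.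
have n2 : (2 < n)%N by near: n; exact: nbhs_infty_gt.
have n0 : 0 < n%:R :> R by rewrite ltr0n (leq_trans _ n2).
have [k k0 kd] : exists2 k, (0 < k)%N & n%:R / k%:R ^+ 2 + (16 * k + 8)%:R / n%:R <= d.
  by near: n; exact: merging_loss_small.
have n_big : 2 * K / e <= n%:R by near: n; exact: nbhs_infty_ger.
pose A := [set x | exists P : 'I_n -> R * R, 0 < MTSP P /\ x = 2 * FWP P / MTSP P].
have ubA : ubound A (K + e).
  by move=> _ [P [M0 ->]]; rewrite -KdE; exact: ratio_le k0 d1 kd M0.
have [P [M0 lowP]] := triangle_ratio R n2.
have inA : A (2 * FWP P / MTSP P) by exists P.
have r_le : r_n R n <= K + e by apply: ge_sup => //; exists (2 * FWP P / MTSP P).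
have le_r : 2 * FWP P / MTSP P <= r_n R n by apply: ub_le_sup => //; exists (K + e).
have : K - e <= K * (1 - 2 / n%:R).
  have : 2 * K / n%:R <= e by rewrite ler_pdivrMr // (mulrC e) -ler_pdivrMr.
  lra.
by rewrite ler_distlC r_le andbT => /le_trans/(_ lowP)/le_trans; apply.
Unshelve. all: by end_near.
Qed.
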